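(* Let $m\ge 2$ and let $x\in\mathbb{Z}_+^{m-1}$ be a Kunz-coordinates vector with $x\neq(1,\ldots,1)$. Then every element of $\mathcal{I}_m(x)$ is of the form $x-\hat y$, where $\hat y$ is a nondominated solution of at least one of the following $m$ multiobjective integer linear programming problems, indexed by $k=1,\ldots,m-1,m$: $$v\text{-}\min\ (y_1,\ldots,y_{m-1})\quad\text{subject to}\quad y\in P^m_k(x).$$
   Context: $\mathbb{Z}_+$ denotes the non-negative integers. A numerical semigroup is a subset $S\subseteq\mathbb{Z}_+$ closed under addition, containing $0$, with $\mathbb{Z}_+\setminus S$ finite. Its multiplicity is $\min(S\setminus\{0\})$, its genus $g(S)$ is $\#(\mathbb{Z}_+\setminus S)$, and its Frobenius number $F(S)$ is the largest integer not in $S$. For $S$ of multiplicity $m$ and $1\le i\le m-1$, let $w_i$ be the least element of $S$ congruent to $i$ modulo $m$. The Kunz-coordinates vector of $S$ is $x\in\mathbb{Z}_+^{m-1}$ with $x_i=(w_i-i)/m$. A vector in $\mathbb{Z}_+^{m-1}$ is a Kunz-coordinates vector if it arises in this way from a (necessarily unique) numerical semigroup of multiplicity $m$. Write $g(x)=g(S)=\sum_{i=1}^{m-1} x_i$ and $F(x)=F(S)=\max_i\{mx_i+i\}-m$. A numerical semigroup of multiplicity $m$ is $m$-irreducible if it is not the intersection of two numerical semigroups of multiplicity $m$ containing it properly. A Kunz-coordinates vector $x$ is $m$-irreducible if its semigroup is, equivalently if $g(x)\in\{m-1,m,\lceil (F(x)+1)/2\rceil\}$. Let $\leq$ be the componentwise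 order and $\mathcal{U}_m(x)=\{x'\in\mathbb{Z}^{m-1}: x'\text{ is a Kunz-coordinates vector and }x'\le x\}$. $\mathcal{I}_m(x)$ is the set of $m$-irreducible $x'\in\mathcal{U}_m(x)$ for which there is no $m$-irreducible $x^*\in\mathcal{U}_m(x)$ with $x^*\ge x'$ and $x^*\ne x'$. For $k\in\{1,\ldots,m-1\}$, $P^m_k(x)$ is the set of $y\in\mathbb{Z}_+^{m-1}$ satisfying - $y_i\le x_i-1$ for all $1\le i\le m-1$; - $y_i+y_j-y_{i+j}\le x_i+x_j-x_{i+j}$ for all $1\le i\le j\le m-1$ with $i+j\le m-1$; - $y_i+y_j-y_{i+j-m}\le x_i+x_j-x_{i+j-m}+1$ for all $1\le i\le j\le m-1$ with $i+j>m$; - $\sum_{i=1}^{m-1}y_i=\sum_{i=1}^{m-1}x_i-\left\lceil\frac{m(x_k-y_k)+k-m+1}{2}\right\rceil$. $P^m_m(x)$ is the set of $y\in\mathbb{Z}_+^{m-1}$ satisfying the first three families of inequalities and $\sum_{i=1}^{m-1}y_i=\sum_{i=1}^{m-1}x_i-m$. A nondominated solution of $v\text{-}\min\ (y_1,\ldots,y_{m-1})$ s.t. $y\in P$ is a $\hat y\in P$ such that no $y\in P$ satisfies $y\le\hat y$ and $y\neq\hat y$. *)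

(* Defs.v *)
From mathcomp Require Import all_boot all_order all_algebra archimedean.
From mathcomp Require Import boolp classical_sets cardinality.

Set Implicit Arguments.
Unset Strict Implicit.
Unset Printing Implicit Defensive.

Import Order.TTheory GRing.Theory Num.Theory.
Local Open Scope classical_set_scope.
Local Open Scope ring_scope.

Definition is_least (A : set nat) (a : nat) : Prop :=
  A a /\ forall b, A b -> (a <= b)%N.

Definition numerical_semigroup (S : set nat) : Prop :=
  [/\ S 0%N,
      forall a b, S a -> S b -> S (a + b)%N &
      finite_set (~` S)].

Definition has_multiplicity (S : set nat) (m : nat) : Prop :=
  is_least (S `\ 0%N) m.

Definition num_sgp_mult (m : nat) (S : set nat) : Prop :=
  numerical_semigroup S /\ has_multiplicity S m.

Definition m_irreducible (m : nat) (S : set nat) : Prop :=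
  num_sgp_mult m S /\
  ~ (exists T1 T2 : set nat,
       [/\ num_sgp_mult m T1, num_sgp_mult m T2,
           S `<` T1, S `<` T2 & S = T1 `&` T2]).

(* Vectors of Z^{m-1} are row vectors ['rV[int]_m.-1].  Mathematically their
   coordinates are numbered 1, ..., m-1, whereas ['I_m.-1] starts at 0:
   [idx i] is the mathematical number of the coordinate [i]. *)
Definition idx (m : nat) (i : 'I_m.-1) : nat := i.+1.

Definition vec_nonneg (m : nat) (x : 'rV[int]_m.-1) : Prop :=
  forall i, 0 <= x 0 i.

Definition vec_le (m : nat) (x y : 'rV[int]_m.-1) : Prop :=
  forall i, x 0 i <= y 0 i.

(* [w - i] is a multiple of [m] below, so the integer quotient is exact. *)
Definition kunz_of (m : nat) (S : set nat) (x : 'rV[int]_m.-1) : Prop :=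
  forall i : 'I_m.-1, exists w : nat,
    is_least [set s | S s /\ s = idx i %[mod m]] w /\
    x 0 i = ((w%:Z - (idx i)%:Z) %/ m%:Z)%Z.

Definition is_kunz (m : nat) (x : 'rV[int]_m.-1) : Prop :=
  vec_nonneg x /\ exists S, num_sgp_mult m S /\ kunz_of S x.

Definition kunz_m_irreducible (m : nat) (x : 'rV[int]_m.-1) : Prop :=
  vec_nonneg x /\
  exists S, [/\ num_sgp_mult m S, kunz_of S x & m_irreducible m S].

Definition undercone (m : nat) (x : 'rV[int]_m.-1) : set 'rV[int]_m.-1 :=
  [set x' | is_kunz x' /\ vec_le x' x].

Definition maximal_irreducibles (m : nat) (x : 'rV[int]_m.-1) :
    set 'rV[int]_m.-1 :=
  [set x' | [/\ undercone x x', kunz_m_irreducible x' &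
     ~ (exists xs, [/\ undercone x xs, kunz_m_irreducible xs,
                       vec_le x' xs & xs <> x'])]].

(* The constraints common to all the feasible regions; in the last two
   families [l] is the coordinate numbered [i + j], resp. [i + j - m]. *)
Definition kunz_constraints (m : nat) (x y : 'rV[int]_m.-1) : Prop :=
  [/\ vec_nonneg y,
      forall i, y 0 i <= x 0 i - 1,
      forall i j l : 'I_m.-1, (i <= j)%N -> (idx i + idx j = idx l)%N ->
        y 0 i + y 0 j - y 0 l <= x 0 i + x 0 j - x 0 l &
      forall i j l : 'I_m.-1, (i <= j)%N -> (idx i + idx j = idx l + m)%N ->
        y 0 i + y 0 j - y 0 l <= x 0 i + x 0 j - x 0 l + 1].

(* P^m_k(x) for 1 <= k <= m-1; the remaining P^m_m(x) has a different genus
   constraint and is [feasible_last]. *)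
Definition feasible (m : nat) (k : 'I_m.-1) (x : 'rV[int]_m.-1) :
    set 'rV[int]_m.-1 :=
  [set y | kunz_constraints x y /\
     \sum_i y 0 i = \sum_i x 0 i
       - Num.ceil ((m%:Z * (x 0 k - y 0 k) + (idx k)%:Z - m%:Z + 1)%:~R / 2%:R
                   : rat)].

Definition feasible_last (m : nat) (x : 'rV[int]_m.-1) : set 'rV[int]_m.-1 :=
  [set y | kunz_constraints x y /\ \sum_i y 0 i = \sum_i x 0 i - m%:Z].

Definition nondominated (m : nat) (P : set 'rV[int]_m.-1)
    (yh : 'rV[int]_m.-1) : Prop :=
  P yh /\ ~ (exists y, [/\ P y, vec_le y yh & y <> yh]).

(* Main.v *)
Require Import Defs.
From mathcomp Require Import all_boot all_order all_algebra.
From mathcomp Require Import boolp classical_sets cardinality.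
From mathcomp Require Import archimedean zify.

Import Order.TTheory GRing.Theory Num.Theory.
Local Open Scope classical_set_scope.
Local Open Scope ring_scope.

(** Write [z = x - y].  The linear constraints on [y] say exactly that [z] is a
    Kunz-coordinates vector with [z <= x] ([kunz_constraintsP]), and the
    equation on the sum of [y] prescribes the genus of [z].  So it has to be
    shown that a maximal irreducible [z] has one of the prescribed genera, and
    that no feasible vector of the same problem lies properly below [y].

    Genera ([m_irreducible_cases]).  Let [F] be the largest gap of an
    irreducible semigroup of multiplicity [m].  If [F < m] then
    [z = (1, ..., 1)]; this is never maximal, because [x <> (1, ..., 1)] has a
    coordinate at least 2 and increasing that coordinate of [(1, ..., 1)] to 2
    gives a larger irreducible vector ([ones_not_maximal]).  If [F] is the only
    gap above [m], the genus is [m], as in the last problem.  Otherwise no two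
    gaps [h] and [F - h] with [h <> F - h] can exist, since then both [F] and a
    second gap could be adjoined and the semigroup would be the intersection of
    the two results ([m_irreducible_pairs]).  Counting gaps in the pairs
    {n, F - n} gives the genus [F / 2 + 1] rounded down, which is the ceiling
    of [(F + 1) / 2]; with [k] the residue of [F], [F = m z_k + k - m], and
    this is the problem of index [k].

    Nondomination.  In the last problem the sum of [y] is fixed, so feasible
    vectors are incomparable.  In the problem of index [k], every feasible [y']
    makes [x - y'] irreducible ([feasible_irreducible]): the number
    [f = m (x - y')_k + k - m] is a gap, and the genus is the least one of any
    semigroup avoiding [f], so every properly larger semigroup contains [f].  A feasible
    [y' <= y] other than [y] would thus contradict the maximality of [z]. *)

(** * Gaps of numerical semigroups *)

Section NumericalSemigroups.
Local Open Scope nat_scope.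

Definition gap_count (S : set nat) (N : nat) : nat := \sum_(n < N) `[< ~ S n >].

Lemma num_sgp_multP {m S} : num_sgp_mult m S ->
  [/\ 0 < m, S 0, S m, forall a b, S a -> S b -> S (a + b) &
      forall s, S s -> s <> 0 -> m <= s].
Proof.
move=> [[S0 Sadd _] [[Sm m0] mmin]]; split=> //; first by rewrite lt0n; apply/eqP.
by move=> s Ss s0; apply: mmin.
Qed.

Lemma sgp_bound {m S} : num_sgp_mult m S -> exists N, forall n, N <= n -> S n.
Proof.
move=> [[_ _ /finite_seqP[s sE]] _]; exists (\max_(i <- s) i).+1 => n Nn.
apply: contrapT => /= Sn; suff : n \in s.
  by move=> /(@leq_bigmax_seq _ _ xpredT (fun i => i) n) /(_ isT); lia.
by have : [set` s] n by rewrite -sE.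
Qed.

Lemma frobenius_exists {m S} : 1 < m -> num_sgp_mult m S ->
  exists2 F, ~ S F & forall n, F < n -> S n.
Proof.
move=> m1 hS; have [_ _ _ _ Smin] := num_sgp_multP hS.
have [N SN] := sgp_bound hS.
have ex : exists n, `[< ~ S n >].
  by exists 1; apply/asboolP => S1; have := Smin _ S1; lia.
have ub n : `[< ~ S n >] -> n <= N.
  by move=> /asboolP Sn; rewrite leqNgt; apply/negP => Nn; apply/Sn/SN/ltnW.
case: (ex_maxnP ex ub) => F /asboolP SF Fmax; exists F => // n Fn.
by apply: contrapT => Sn; have := Fmax n (asboolT Sn); lia.
Qed.

Lemma gap_count_tail {S} N N' : (forall n, N <= n < N' -> S n) -> N <= N' ->
  gap_count S N' = gap_count S N.
Proof.
elim: N' => [|N' IH] SN NN'; first by have -> : N = 0 by lia.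
have [->//|NN1] := eqVneq N N'.+1.
rewrite /gap_count big_ord_recr /= -/(gap_count _ _).
rewrite IH; [|by move=> n ?; apply: SN; lia|by lia].
by rewrite asboolF ?addn0 //; apply; apply: SN; lia.
Qed.

Lemma leq_gap_count {S} N N' : N <= N' -> gap_count S N <= gap_count S N'.
Proof.
elim: N' => [|N' IH] NN'; first by have -> : N = 0 by lia.
have [->//|NN1] := eqVneq N N'.+1.
by rewrite [in leqRHS]/gap_count big_ord_recr /= -/(gap_count _ _); have := IH; lia.
Qed.

(** Reflection [n |-> f - n] of the interval [0, f] turns twice the number of
    gaps into a sum of contributions of the pairs {n, f - n}. *)
Lemma gap_count_double S f : (gap_count S f.+1).*2 =
  \sum_(n < f.+1) (`[< ~ S n >] + `[< ~ S (f - n) >]).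
Proof.
rewrite big_split /= -addnn; congr (_ + _).
by rewrite /gap_count (reindex_inj rev_ord_inj); apply: eq_bigr => i _ /=; rewrite subSS.
Qed.

(** If [f] is a gap, a pair {n, f - n} cannot consist of two elements of the
    semigroup, so every pair contributes at least one gap. *)
Lemma gap_count_ge {m S} f N : num_sgp_mult m S -> ~ S f -> f < N ->
  f./2 < gap_count S N.
Proof.
move=> /num_sgp_multP[_ _ _ Sadd _] Sf fN.
have : f.+1 <= (gap_count S f.+1).*2.
  rewrite gap_count_double -[leqLHS]card_ord -sum1_card.
  apply: leq_sum => n _; have nf := ltn_ord n.
  case: asboolP => // /contrapT Sn; case: asboolP => // /contrapT Sfn.
  by exfalso; apply: Sf; rewrite -(@subnKC n f nf); apply: Sadd.
have := leq_gap_count _ _ fN (S := S); lia.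
Qed.

(** When [n = f - n] is the only pair made of two gaps, the bound of
    [gap_count_ge] is attained. *)
Lemma gap_count_le {S} f :
  (forall h, h <= f -> ~ S h -> ~ S (f - h) -> h.*2 = f) ->
  gap_count S f.+1 <= f./2.+1.
Proof.
move=> bal; have : (gap_count S f.+1).*2 <= f.+2.
  rewrite gap_count_double.
  apply: (@leq_trans (\sum_(n < f.+1) (1 + (nat_of_ord n == f./2)))).
    apply: leq_sum => n _; have nf := ltn_ord n.
    case: asboolP => // Sn; case: asboolP => // Sfn.
    by have := bal n nf Sn Sfn; lia.
  rewrite big_split /= sum1_card card_ord.
  have -> : \sum_(n < f.+1) (nat_of_ord n == f./2 : nat) = 1; last by lia.
  rewrite -(big_mkcond (fun n : 'I_f.+1 => nat_of_ord n == f./2) (fun=> 1)).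
  by rewrite (big_ord1_eq _ (fun=> 1)) ifT; lia.
lia.
Qed.

(** * Irreducible semigroups of given multiplicity *)

(** Two oversemigroups whose intersection misses [f] cannot both contain it. *)
Lemma m_irreducible_of_gap {m S} f : num_sgp_mult m S -> ~ S f ->
  (forall T, num_sgp_mult m T -> S `<` T -> T f) -> m_irreducible m S.
Proof.
move=> hS Sf hf; split=> // -[T1 [T2 [h1 h2 l1 l2 E]]].
by apply: Sf; rewrite E; split; apply: hf.
Qed.

(** An oversemigroup has fewer gaps, hence fewer than is possible for a
    semigroup avoiding [f]. *)
Lemma m_irreducible_of_genus {m S} f N : num_sgp_mult m S -> ~ S f ->
  (forall n, N <= n -> S n) -> gap_count S N = f./2.+1 -> m_irreducible m S.
Proof.
move=> hS Sf SN gS; apply: (m_irreducible_of_gap f) => // T hT [ST nTS].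
apply: contrapT => Tf.
have fN : f < N by rewrite ltnNge; apply/negP => /SN.
have := gap_count_ge f N hT Tf fN; rewrite -gS leqNgt => /negP; apply.
have [t [Tt St]] : exists t, T t /\ ~ S t.
  apply: contrapT => no; apply: nTS => t Tt; apply: contrapT => St.
  by apply: no; exists t.
have tN : t < N by rewrite ltnNge; apply/negP => /SN.
rewrite /gap_count (bigD1 (Ordinal tN)) //= [in leqRHS](bigD1 (Ordinal tN)) //=.
rewrite asboolF; last by apply.
rewrite [in leqRHS]asboolT // add0n add1n ltnS; apply: leq_sum => n _.
by case: asboolP => // Tn; rewrite asboolT // => Sn; apply/Tn/ST.
Qed.

(** Apart from [h] itself, all new sums [h + h] and [h + s] are supposed to be
    in [S] already; [m < h] preserves the multiplicity. *)
Lemma num_sgp_mult_adjoin {m S} h : num_sgp_mult m S -> m < h ->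
  S (h + h) -> (forall s, S s -> s <> 0 -> S (h + s)) ->
  num_sgp_mult m (S `|` [set h]).
Proof.
move=> hS mh Shh Shs; have [m0 S0 Sm Sadd Smin] := num_sgp_multP hS.
case: (hS) => -[_ _ fin] _; split; split.
- by left.
- have aux a : S a -> (S `|` [set h]) (h + a).
    move=> Sa; have [->|/eqP a0] := eqVneq a 0; first by right; rewrite /= addn0.
    by left; apply: Shs.
  move=> a b [Sa|->] [Sb|->]; [by left; apply: Sadd | | exact: aux | by left].
  by rewrite addnC; apply: aux.
- by apply: sub_finite_set fin => n /= nS Sn; apply: nS; left.
- by split; [left | move=> /= E; rewrite E in m0].
- by move=> b [[Sb|->] b0]; [apply: Smin | apply: ltnW].
Qed.

(** If [h] and [h'] differ, [S] is the intersection of the two semigroups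
    obtained by adjoining one of them. *)
Lemma adjoin_unique {m S} h h' : m_irreducible m S -> ~ S h -> ~ S h' ->
  num_sgp_mult m (S `|` [set h]) -> num_sgp_mult m (S `|` [set h']) -> h = h'.
Proof.
move=> [hS irr] Sh Sh' ah ah'; apply: contrapT => hh'; apply: irr.
have lt k : ~ S k -> S `<` S `|` [set k].
  by move=> Sk; split=> [n|sub]; [left | apply/Sk/sub; right].
exists (S `|` [set h]), (S `|` [set h']); split; [by []|by []|exact: lt|exact: lt|].
rewrite -setUIr; apply/seteqP; split=> n; first by left.
by case=> // -[/= -> E]; case: hh'.
Qed.

(** The largest gap [h] other than [F / 2] such that [F - h] is also a gap could
    be adjoined to the semigroup, and so could [F]; an irreducible semigroup
    does not allow both.  The hypothesis on [h0] covers [F < 2 * m], where that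
    [h] may lie below [m] but every gap above [m] can be adjoined. *)
Lemma m_irreducible_pairs {m S} F h0 : m_irreducible m S -> ~ S F ->
  (forall n, F < n -> S n) -> m < F -> ~ S h0 -> m < h0 -> h0 <> F ->
  forall h, h <= F -> ~ S h -> ~ S (F - h) -> h.*2 = F.
Proof.
move=> irr SF Fmax mF Sh0 mh0 h0F; have hS := irr.1.
have [m0 S0 Sm Sadd Smin] := num_sgp_multP hS.
have adjF : num_sgp_mult m (S `|` [set F]).
  by apply: num_sgp_mult_adjoin => // [|s _ s0]; apply: Fmax; lia.
(* Otherwise all sums involving [h0] exceed [F], and [h0] can be adjoined. *)
have F2m : m.*2 < F.
  rewrite ltnNge; apply/negP => F2m; apply: h0F; apply: (adjoin_unique _ _ irr) => //.
  apply: num_sgp_mult_adjoin => // [|s Ss s0]; apply: Fmax; first lia.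
  by have := Smin _ Ss s0; lia.
(* Downward induction on [h]: an obstruction to adjoining [h] is a larger gap
   [h + s] with the same property, because [F - h = F - (h + s) + s]. *)
have upper k h : F - h <= k -> h <= F -> F < h.*2 -> ~ S h -> ~ S (F - h) -> False.
  elim: k h => [|k IH] h hk hF Fh Sh SFh.
    by apply: SFh; have -> : F - h = 0 by lia.
  have hneF : h <> F by move=> E; apply: SFh; rewrite E subnn.
  apply: hneF; apply: (adjoin_unique _ _ irr) => //.
  apply: num_sgp_mult_adjoin => // [||s Ss s0]; first lia.
    by apply: Fmax; lia.
  apply: contrapT => Shs.
  have hsF : h + s <= F by rewrite leqNgt; apply/negP => /Fmax.
  apply: (IH (h + s)) => //; try lia.
  move=> Sc; apply: SFh; have -> : F - h = F - (h + s) + s by lia.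
  exact: Sadd.
move=> h hF Sh SFh; case: (ltngtP h.*2 F) => // hh; exfalso.
  by apply: (upper (F - (F - h)) (F - h)); rewrite ?subKn //; lia.
exact: (upper (F - h) h).
Qed.

(** Every pair {n, F - n} contains exactly one gap, unless [n = F - n]. *)
Lemma m_irreducible_genus {m S} F h0 : m_irreducible m S -> ~ S F ->
  (forall n, F < n -> S n) -> m < F -> ~ S h0 -> m < h0 -> h0 <> F ->
  gap_count S F.+1 = F./2.+1.
Proof.
move=> irr SF Fmax mF Sh0 mh0 h0F; apply/eqP; rewrite eqn_leq.
rewrite (gap_count_ge F F.+1 irr.1) // andbT; apply: gap_count_le.
exact: m_irreducible_pairs Sh0 mh0 h0F.
Qed.

End NumericalSemigroups.

(** * Kunz coordinates *)

Section KunzCoordinates.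
Local Open Scope nat_scope.

(** The coordinates numbered by naturals, extended by 0 at the residue 0,
    where the least element of a semigroup is 0. *)
Definition coord {m} (x : 'rV[int]_m.-1) (r : nat) : nat :=
  \sum_(i < m.-1 | idx i == r) `|x 0%R i|.

Lemma coord0 {m} (x : 'rV[int]_m.-1) : coord x 0 = 0.
Proof. by rewrite /coord big_pred0. Qed.

Lemma coord_idx {m} (x : 'rV[int]_m.-1) i : coord x (idx i) = `|x 0%R i|.
Proof. by rewrite /coord (big_pred1 i) // => j; rewrite /idx eqSS. Qed.

Lemma idx_surj {m} r : 0 < r -> r < m -> exists i : 'I_m.-1, idx i = r.
Proof.
move=> r0 rm; have h : r.-1 < m.-1 by lia.
by exists (Ordinal h); rewrite /idx /=; lia.
Qed.

Lemma ltn_idx {m} (i : 'I_m.-1) : idx i < m.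
Proof. by rewrite /idx; have := ltn_ord i; lia. Qed.

(** A semigroup of multiplicity [m] is determined by its least elements in the
    residue classes, hence by its Kunz coordinates. *)
Lemma kunz_ofP {m S} {x : 'rV[int]_m.-1} : num_sgp_mult m S -> kunz_of S x ->
  forall n, S n <-> coord x (n %% m) <= n %/ m.
Proof.
move=> hS hK n; have [m0 S0 Sm Sadd Smin] := num_sgp_multP hS.
have Skm k : S (k * m).
  by elim: k => [|k IH]; rewrite ?mul0n // mulSn; apply: Sadd.
have [r0|] := posnP (n %% m).
  rewrite r0 coord0 (divn_eq n m) r0 addn0.
  by split.
move=> r0; have [i ir] := idx_surj _ r0 (ltn_pmod n m0).
have [w [[[Sw wi] wmin] xE]] := hK i.
have im := ltn_idx i.
rewrite -ir coord_idx xE.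
have wE : w = w %/ m * m + idx i by rewrite {1}(divn_eq w m) wi modn_small.
have -> : (w%:Z - (idx i)%:Z)%R = ((w %/ m)%:Z * m%:Z)%R by lia.
rewrite mulzK; last by lia.
rewrite /=; split=> [Sn|le].
  by apply: leq_div2r; apply: wmin; split=> //; rewrite ir modn_mod.
have -> : n = w + (n %/ m - w %/ m) * m; last by apply: Sadd.
move: (w %/ m) wE le => q -> le; rewrite {1}(divn_eq n m) -ir mulnBl.
have : q * m <= n %/ m * m by rewrite leq_mul2r le orbT.
lia.
Qed.

Lemma kunz_gap {m S} {x : 'rV[int]_m.-1} : num_sgp_mult m S -> kunz_of S x ->
  forall n, ~ S n <-> n %/ m < coord x (n %% m).
Proof. by move=> hS hK n; rewrite (kunz_ofP hS hK) ltnNge; split => /negP. Qed.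

(** The residue class [r] contains exactly [coord x r] gaps, which begin at
    [r] and follow each other at distance [m]. *)
Lemma genus_kunz {m S} {x : 'rV[int]_m.-1} N : num_sgp_mult m S ->
  vec_nonneg x -> kunz_of S x -> (forall n, N <= n -> S n) ->
  (\sum_i x 0%R i)%R = (gap_count S N)%:Z.
Proof.
move=> hS x0 hK SN; have [m0 _ _ _ _] := num_sgp_multP hS.
(* Count by blocks of [m] consecutive integers, one from each class. *)
have count K : gap_count S (K * m) = \sum_(r < m) minn K (coord x r).
  elim: K => [|K IH].
    by rewrite /gap_count mul0n big_ord0 big1 // => r _; rewrite min0n.
  rewrite mulSnr /gap_count big_split_ord /= -/(gap_count S (K * m)) IH -big_split /=.
  apply: eq_bigr => r _; rewrite (_ : `[< _ >] = (K < coord x r)); first by lia.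
  apply: (sameP (asboolP _)); apply: (iffP idP) => h.
    by apply/(kunz_gap hS hK); rewrite divnMDl // modnMDl divn_small // modn_small // addn0.
  by move/(kunz_gap hS hK): h; rewrite divnMDl // modnMDl divn_small // modn_small // addn0.
pose K := N + \sum_(r < m) coord x r.
have NK : N <= K * m by apply: leq_trans (leq_pmulr _ m0); apply: leq_addr.
rewrite -(gap_count_tail N (K * m)) // => [|n /andP[/SN //]]; rewrite count.
have -> : \sum_(r < m) minn K (coord x r) = \sum_(r < m) coord x r.
  apply: eq_bigr => r _; apply/minn_idPr; rewrite /K (bigD1 r) //=; lia.
have -> : \sum_(r < m) coord x r = \sum_(i < m.-1) `|x 0%R i|.
  case: m m0 x {x0 hK hS count K NK} => // m _ x.
  rewrite big_ord_recl coord0 add0n; apply: eq_bigr => i _.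
  exact: (coord_idx x i).
rewrite (big_morph Posz (id1 := 0%R) (op1 := +%R) PoszD erefl).
by apply: eq_bigr => i _; have := x0 i; lia.
Qed.

Definition kunz_inequalities {m} (x : 'rV[int]_m.-1) : Prop :=
  [/\ forall i, (1 <= x 0%R i)%R,
      forall i j l : 'I_m.-1, idx i + idx j = idx l ->
        (x 0%R l <= x 0%R i + x 0%R j)%R &
      forall i j l : 'I_m.-1, idx i + idx j = idx l + m ->
        (x 0%R l <= x 0%R i + x 0%R j + 1)%R].

(** Closure under addition, read off on the least elements of the classes of
    [r] and [s]; the carry occurs when [r + s] reaches [m]. *)
Lemma coord_subadd {m} {x : 'rV[int]_m.-1} r s : kunz_inequalities x ->
  r < m -> s < m ->
  coord x ((r + s) %% m) <= coord x r + coord x s + (m <= r + s).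
Proof.
move=> [x1 xlo xhi] rm sm.
have [->|r0] := posnP r; first by rewrite add0n modn_small //; lia.
have [->|s0] := posnP s; first by rewrite addn0 modn_small //; lia.
have [i ir] := idx_surj r r0 rm; have [j js] := idx_surj s s0 sm.
have := x1 i; have := x1 j; rewrite -ir -js !coord_idx => xi xj.
case: (ltngtP (idx i + idx j) m) => h.
- rewrite modn_small //.
  have [l lE] := idx_surj (idx i + idx j) ltac:(lia) h.
  by rewrite -lE coord_idx; have := xlo i j l (esym lE); have := x1 l; lia.
- rewrite -(subnK (ltnW h)) modnDr modn_small; last by lia.
  have [l lE] := @idx_surj m (idx i + idx j - m) ltac:(lia) ltac:(lia).
  rewrite -lE coord_idx; have := x1 l.
  by have := xhi i j l ltac:(lia); lia.
- by rewrite h modnn coord0.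
Qed.

Lemma kunz_exists {m} {x : 'rV[int]_m.-1} : 1 < m -> kunz_inequalities x ->
  exists2 S, num_sgp_mult m S & kunz_of S x.
Proof.
move=> m1 hx; have [x1 _ _] := hx; have m0 : 0 < m by lia.
pose S := [set n | coord x (n %% m) <= n %/ m]; exists S.
- split; split.
  + by rewrite /S /= mod0n coord0.
  + move=> a b; rewrite /S /= => Sa Sb; rewrite divnD // -modnDm.
    have := coord_subadd (a %% m) (b %% m) hx (ltn_pmod _ m0) (ltn_pmod _ m0).
    lia.
  + pose K := \sum_(r < m) coord x r.
    apply: sub_finite_set (finite_II (K * m)) => n /= Sn.
    rewrite ltnNge; apply/negP => Kn; apply: Sn.
    apply: (@leq_trans K); last by rewrite leq_divRL.
    by rewrite /K (bigD1 (Ordinal (ltn_pmod n m0))) //= leq_addr.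
  + by split; [rewrite /S /= modnn coord0 | move=> /=; lia].
  + move=> b [Sb /= b0]; rewrite leqNgt; apply/negP => bm; move: Sb.
    have [i ib] := @idx_surj m b ltac:(lia) bm.
    by rewrite /S /= modn_small // divn_small // -ib coord_idx; have := x1 i; lia.
- move=> i; have im := ltn_idx i; have xi := x1 i.
  exists (`|x 0%R i| * m + idx i); split; last first.
    have -> : ((`|x 0%R i| * m + idx i)%:Z - (idx i)%:Z)%R = (x 0%R i * m%:Z)%R.
      by lia.
    by rewrite mulzK //; lia.
  split; first by rewrite /S /= modnMDl modn_small // divnMDl // divn_small // addn0 coord_idx.
  move=> b [Sb bi]; move: Sb; rewrite /S /= bi modn_small // coord_idx => le.
  rewrite (divn_eq b m) bi (modn_small im) leq_add2r leq_mul2r le orbT //.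
Qed.

(** The sum of the least elements of the classes of [i] and [j] lies in the
    semigroup, hence is at least the least element of its own class. *)
Lemma is_kunzP {m} {x : 'rV[int]_m.-1} : 1 < m ->
  is_kunz x <-> kunz_inequalities x.
Proof.
move=> m1; split=> [[x0 [S [hS hK]]]|hx]; last first.
  have [S hS hK] := kunz_exists m1 hx; split; last by exists S.
  by move=> i; have [/(_ i) + _ _] := hx; lia.
have [m0 S0 Sm Sadd Smin] := num_sgp_multP hS.
have memS (i : 'I_m.-1) : S (`|x 0%R i| * m + idx i).
  apply/(kunz_ofP hS hK); have im := ltn_idx i.
  by rewrite modnMDl modn_small // divnMDl // divn_small // addn0 coord_idx.
have leS (l : 'I_m.-1) k : S (k * m + idx l) -> `|x 0%R l| <= k.
  move=> /(kunz_ofP hS hK); have lm := ltn_idx l.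
  by rewrite modnMDl modn_small // divnMDl // divn_small // addn0 coord_idx.
split=> [i|i j l E|i j l E].
- have := x0 i; have := memS i; have := ltn_idx i; rewrite /idx => im.
  case: (posnP `|x 0%R i|) => [->|]; last by lia.
  by rewrite mul0n => /Smin; lia.
- have := Sadd _ _ (memS i) (memS j).
  have -> : `|x 0%R i| * m + idx i + (`|x 0%R j| * m + idx j) =
            (`|x 0%R i| + `|x 0%R j|) * m + idx l by rewrite -E; lia.
  by move=> /leS; have := x0 i; have := x0 j; have := x0 l; lia.
- have := Sadd _ _ (memS i) (memS j).
  have -> : `|x 0%R i| * m + idx i + (`|x 0%R j| * m + idx j) =
            (`|x 0%R i| + `|x 0%R j| + 1) * m + idx l by lia.
  by move=> /leS; have := x0 i; have := x0 j; have := x0 l; lia.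
Qed.

End KunzCoordinates.

(** * The feasible regions and the maximal irreducible vectors *)

Lemma coordB {m} (x y : 'rV[int]_m.-1) i : (x - y) 0 i = x 0 i - y 0 i.
Proof. by rewrite !mxE. Qed.

(** Each constraint is one of the inequalities of [kunz_inequalities] for
    [x - y], rearranged; these are symmetric in [i] and [j], so restricting
    them to [i <= j] loses nothing. *)
Lemma kunz_constraintsP {m} {x y : 'rV[int]_m.-1} : (1 < m)%N ->
  kunz_constraints x y <-> vec_nonneg y /\ is_kunz (x - y).
Proof.
move=> m1; rewrite (is_kunzP m1); split.
  move=> [y0 yx lo hi]; split=> //; split=> [i|i j l E|i j l E].
  - by rewrite !coordB; have := yx i; lia.
  - rewrite !coordB; case/orP: (leq_total i j) => ij.
      by have := lo i j l ij E; lia.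
    by have := lo j i l ij ltac:(lia); lia.
  - rewrite !coordB; case/orP: (leq_total i j) => ij.
      by have := hi i j l ij E; lia.
    by have := hi j i l ij ltac:(lia); lia.
move=> [y0 [x1 lo hi]]; split=> // [i|i j l _ E|i j l _ E].
- by have := x1 i; rewrite !coordB; lia.
- by have := lo i j l E; rewrite !coordB; lia.
- by have := hi i j l E; rewrite !coordB; lia.
Qed.

Lemma ceil_half (z : int) (n : nat) : z = n%:Z + 1 ->
  Num.ceil (z%:~R / 2%:R : rat) = (n./2.+1)%:Z.
Proof.
move=> ->; apply: ceil_def; have := odd_double_half n => nE.
rewrite ltr_pdivlMr // ler_pdivrMr // -[2%:R]/((2%:Z)%:~R) -!intrM.
by rewrite ltr_int ler_int; apply/andP; split; lia.
Qed.

(** The semigroup consists of 0 and all integers from [m] on except [m + i],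
    so every larger semigroup of multiplicity [m] contains [m + i]. *)
Lemma ones_add_delta_irreducible {m} (i : 'I_m.-1) : (1 < m)%N ->
  let v := const_mx 1 + delta_mx 0 i : 'rV[int]_m.-1 in
  is_kunz v /\ kunz_m_irreducible v.
Proof.
move=> m1 v.
have vE j : v 0 j = 1 + (j == i)%:Z by rewrite !mxE /=; case: (j == i).
have hv : kunz_inequalities v.
  split=> [j|j k l _|j k l _]; rewrite !vE; lia.
have [S hS hK] := kunz_exists m1 hv.
have v0 : vec_nonneg v by move=> j; rewrite vE; lia.
have m0 : (0 < m)%N by lia.
split; first by apply/(is_kunzP m1).
split=> //; exists S; split=> //.
have im := ltn_idx i.
apply: (m_irreducible_of_gap (m + idx i)) => // [|T hT [ST nTS]].
  apply/(kunz_gap hS hK); rewrite modnDl modn_small // divnDl // divnn m0.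
  by rewrite divn_small // addn0 coord_idx vE eqxx.
have [t [Tt St]] : exists t, T t /\ ~ S t.
  apply: contrapT => no; apply: nTS => t Tt; apply: contrapT => St.
  by apply: no; exists t.
suff <- : t = (m + idx i)%N by [].
have [_ S0 _ _ _] := num_sgp_multP hS.
have [_ _ _ _ Tmin] := num_sgp_multP hT.
have tm : (m <= t)%N by apply: Tmin => // t0; apply: St; rewrite t0.
have t1 : (1 <= t %/ m)%N by rewrite divn_gt0.
move/(kunz_gap hS hK): St; have [->|r0] := posnP (t %% m); first by rewrite coord0.
have [j jt] := idx_surj _ r0 (ltn_pmod t m0).
rewrite -jt coord_idx vE; have [ji|] := eqVneq j i; last by lia.
move=> lt2; rewrite (divn_eq t m) -jt ji; have -> : (t %/ m = 1)%N by lia.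
by rewrite mul1n.
Qed.

(** The genus of [x - y] is the smallest one compatible with the last gap [f] of
    the residue class [k].  This is enough even if [f] is not the largest of all
    gaps, because the genus bound holds for every gap. *)
Lemma feasible_irreducible {m} {k : 'I_m.-1} {x y : 'rV[int]_m.-1} :
  (1 < m)%N -> feasible k x y -> kunz_m_irreducible (x - y).
Proof.
move=> m1 [/(kunz_constraintsP m1)[_ hz] sumE].
have [z1 _ _] := (is_kunzP m1).1 hz.
have [z0 [S [hS hK]]] := hz; split=> //; exists S; split=> //.
have km := ltn_idx k; have m0 : (0 < m)%N by lia.
have := z1 k; set zk := (x - y) 0 k => zk1.
pose f := ((`|zk|%N - 1) * m + idx k)%N.
have [N SN] := sgp_bound hS.
apply: (m_irreducible_of_genus f N) => //.
  apply/(kunz_gap hS hK); rewrite modnMDl modn_small // divnMDl // divn_small //.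
  by rewrite addn0 coord_idx -/zk; lia.
apply/eqP; rewrite -eqz_nat -(genus_kunz N hS z0 hK SN); apply/eqP.
have fE : m%:Z * (x 0 k - y 0 k) + (idx k)%:Z - m%:Z + 1 = f%:Z + 1.
  have : zk = x 0 k - y 0 k by rewrite /zk coordB.
  have -> : zk = (`|zk|%N - 1)%N%:Z + 1 by lia.
  by move=> <-; rewrite /f PoszD PoszM; lia.
move: sumE; rewrite (ceil_half _ _ fE).
by rewrite (eq_bigr _ (fun i _ => coordB x y i)) sumrB => ->; rewrite subKr.
Qed.

(** The three cases are those of a largest gap [F] below [m], of an [F] that is
    the only gap above [m], and of a further gap above [m]; in the last one [k]
    is the residue of [F] modulo [m]. *)
Lemma m_irreducible_cases {m} {z : 'rV[int]_m.-1} : (1 < m)%N ->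
  kunz_m_irreducible z ->
  [\/ z = const_mx 1,
      \sum_i z 0 i = m%:Z |
      exists k, \sum_i z 0 i =
        Num.ceil ((m%:Z * z 0 k + (idx k)%:Z - m%:Z + 1)%:~R / 2%:R : rat)].
Proof.
move=> m1 [z0 [S [hS hK irr]]]; have m0 : (0 < m)%N by lia.
have hz : is_kunz z by split=> //; exists S.
have [z1 _ _] := (is_kunzP m1).1 hz.
have [_ S0 Sm Sadd Smin] := num_sgp_multP hS.
have [F SF Fmax] := frobenius_exists m1 hS.
have gE := genus_kunz F.+1 hS z0 hK Fmax.
case: (ltngtP F m) => [Fm|mF|E]; last by rewrite E in SF.
  constructor 1; apply/rowP => i; rewrite mxE.
  have : S (m + idx i)%N by apply: Fmax; lia.
  have im := ltn_idx i.
  move/(kunz_ofP hS hK); rewrite modnDl modn_small // divnDl // divnn m0.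
  by rewrite divn_small // addn0 coord_idx; have := z1 i; lia.
have [[h [Sh mh hF]]|no] := pselect (exists h, [/\ ~ S h, (m < h)%N & h <> F]).
  constructor 3; have FS := (kunz_gap hS hK F).1 SF.
  have [r0|r0] := posnP (F %% m); first by rewrite r0 coord0 in FS.
  have [k kF] := idx_surj _ r0 (ltn_pmod F m0); exists k.
  have : S (F + m)%N by apply: Fmax; lia.
  move/(kunz_ofP hS hK); rewrite modnDr divnDr // divnn m0.
  rewrite -kF coord_idx in FS * => le.
  rewrite gE (m_irreducible_genus F h irr) //; apply/esym/ceil_half.
  have zk : z 0 k = (F %/ m)%:Z + 1 by have := z1 k; lia.
  have FE := divn_eq F m; rewrite zk -kF in FE *.
  by rewrite {2}FE; lia.
constructor 2; rewrite gE.
rewrite /gap_count big_ord_recr /= asboolT //.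
congr Posz.
rewrite -/(gap_count S F).
have : gap_count S F = (m.-1)%N; last by lia.
rewrite (gap_count_tail m F) => [|n /andP[mn nF]|]; last by lia.
  case: m m0 Smin S0 {m1 z z0 hS hK irr hz z1 Sm mF no gE} => // m _ Smin S0.
  rewrite /gap_count big_ord_recl asboolF; last by apply.
  rewrite add0n -[in RHS](card_ord m) -sum1_card; apply: eq_bigr => i _.
  by rewrite asboolT // => /Smin; have := ltn_ord i; rewrite /= /bump /=; lia.
apply: contrapT => Sn; apply: no; exists n; split=> //; last by lia.
by rewrite ltn_neqAle mn andbT; apply: contra_notN Sn => /eqP <-.
Qed.

Lemma vec_le_sum_eq {m} {y z : 'rV[int]_m.-1} : vec_le y z ->
  \sum_i y 0 i = \sum_i z 0 i -> y = z.
Proof.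
move=> yz sumE; apply/rowP => i; apply/esym/eqP; rewrite -subr_eq0; apply/eqP.
have pos j : xpredT j -> 0 <= z 0 j - y 0 j by rewrite subr_ge0.
by apply: (psumr_eq0P pos) => //; rewrite sumrB sumE subrr.
Qed.

(** Since [x] has a coordinate at least 2, it still lies above the vector
    obtained from [(1, ..., 1)] by increasing that coordinate to 2, and this
    vector is irreducible. *)
Lemma ones_not_maximal {m} {x : 'rV[int]_m.-1} : (1 < m)%N -> is_kunz x ->
  x <> const_mx 1 -> ~ maximal_irreducibles x (const_mx 1).
Proof.
move=> m1 /(is_kunzP m1)[x1 _ _] xn1 [_ _]; apply.
have [i xi] : exists i, 2 <= x 0 i.
  apply: contrapT => no; apply: xn1; apply/rowP => i; rewrite mxE.
  by apply/eqP; rewrite eq_le x1 andbT leNgt; apply/negP => xi; apply: no; exists i.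
have [vK vI] := ones_add_delta_irreducible i m1.
set v := _ + _ in vK vI.
have vE j : v 0 j = 1 + (j == i)%:Z by rewrite !mxE /=; case: (j == i).
exists v; split=> //.
- split=> // j; rewrite vE; have := x1 j.
  by have [->|] := eqVneq j i; [have := xi|]; lia.
- by move=> j; rewrite vE mxE; lia.
- by move/rowP/(_ i); rewrite vE eqxx mxE.
Qed.

Theorem theorem18 (m : nat) (hm : (2 <= m)%N) (x : 'rV[int]_m.-1)
    (hx : is_kunz x) (hx1 : x <> const_mx 1) :
  forall x' : 'rV[int]_m.-1, maximal_irreducibles x x' ->
  exists yh : 'rV[int]_m.-1,
    x' = x - yh /\
    ((exists k : 'I_m.-1, nondominated (feasible k x) yh) \/
     nondominated (feasible_last x) yh).
Proof.
move=> x' x'max; have [[x'K x'x] x'I nomax] := x'max.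
pose y := x - x'; have x'E : x - y = x' by rewrite /y subKr.
have yc : kunz_constraints x y.
  apply/(kunz_constraintsP hm); rewrite x'E; split=> // i.
  by rewrite /y coordB subr_ge0.
have sumy c : \sum_i x' 0 i = c -> \sum_i y 0 i = \sum_i x 0 i - c.
  by move=> <-; rewrite -sumrB; apply: eq_bigr => i _; rewrite coordB.
exists y; split; first by [].
have [x'1|sumE|[k sumE]] := m_irreducible_cases hm x'I.
- by rewrite x'1 in x'max; case: (ones_not_maximal hm hx hx1).
- right; split; first by split; rewrite // (sumy m%:Z).
  move=> [y2 [[_ sum2] le2 ne]]; apply/ne/(vec_le_sum_eq le2).
  by rewrite sum2 (sumy m%:Z).
- left; exists k; split.
    split=> //; rewrite (sumy _ sumE).
    by rewrite -[in RHS]coordB x'E.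
  move=> [y2 [y2P le2 ne]]; apply: nomax; exists (x - y2).
  have [/(kunz_constraintsP hm)[y2ge0 y2K] _] := y2P.
  split.
  + by split=> // i; rewrite coordB gerBl y2ge0.
  + exact: feasible_irreducible hm y2P.
  + by move=> i; rewrite -x'E (coordB x y) (coordB x y2) lerD2l lerN2 le2.
  + by rewrite -x'E => /addrI/oppr_inj.
Qed.
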